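(* Let $0<a<1$ and let $T\in L(H)$ be an $a$-contraction on a Hilbert space $H$. Then $T$ is quadratically $(C,b)$-bounded for any $b>1-a$.
   Context: Hilbert spaces are separable and complex. The Cesàro numbers $k^{-s}(n)$ ($s\in\mathbb{R}$) are defined by $(1-t)^s=\sum_{n=0}^\infty k^{-s}(n)t^n$, $|t|<1$; thus $(1-t)^{-b}=\sum_n k^b(n)t^n$. Write $(1-t)^a=\sum_n\alpha_nt^n$. $T\in L(H)$ is an $a$-contraction if $\sum_n|\alpha_n|T^{*n}T^n$ converges in the strong operator topology and $(1-t)^a(T^*,T):=\sum_{n\ge0}\alpha_nT^{*n}T^n\ge0$. $T$ is quadratically $(C,b)$-bounded if there is a constant $c>0$ such that $$\sup_{n\ge0}\frac{1}{k^{b+1}(n)}\sum_{j=0}^nk^b(n-j)\|T^jx\|^2\le c\|x\|^2\qquad\text{for all }x\in H.$$ *)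

(* Defs.v *)
From HB Require Import structures.
From mathcomp Require Import all_boot all_order all_algebra.
From mathcomp Require Import all_classical all_reals all_analysis.
From mathcomp Require Import complex ring lra.
Import Order.TTheory GRing.Theory Num.Theory.
Import numFieldNormedType.Exports.

Set Implicit Arguments.
Unset Strict Implicit.
Unset Printing Implicit Defensive.

Local Open Scope classical_set_scope.
Local Open Scope ring_scope.
Local Open Scope complex_scope.

(* The inner product is linear in its first argument and conjugate-linear in
   the second one. *)
HB.mixin Record CompleteNormedModule_isHilbert (R : realType) H
    of CompleteNormedModule R[i] H := {
  dotp : {dot H for @Num.conj R[i]};
  dotp_norm : forall x : H, dotp x x = `|x| ^+ 2
}.

#[short(type="hilbertType")]
HB.structure Definition Hilbert (R : realType) :=
  {H of CompleteNormedModule R[i] H & CompleteNormedModule_isHilbert R H}.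

Definition separable (T : topologicalType) :=
  exists2 D : set T, countable D & dense D.

(* The norm of a [completeNormedModType R[i]] takes its values in [R[i]]; this
   is the same norm as an element of [R]. *)
Definition hnorm (R : realType) (H : hilbertType R) (x : H) : R :=
  complex.Re `|x|.

(* For a continuous linear [T], the vector exists by the Riesz representation
   theorem: see [adjointP] below. *)
Definition adjoint (R : realType) (H : hilbertType R) (T : H -> H) (y : H) : H :=
  xget 0 [set z | forall x, dotp (T x) y = dotp x z].

Definition sot_cvg (R : realType) (H : hilbertType R) (S : nat -> H -> H) :=
  exists A : {linear H -> H},
    continuous A /\ forall x, S n x @[n --> \oo] --> A x.

(* In the partial order of [R[i]], [0 <= z] says that [z] is real and
   nonnegative. *)
Definition positive_op (R : realType) (H : hilbertType R) (A : H -> H) :=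
  forall x, 0 <= dotp (A x) x.

Definition is_cesaro_num (R : realType) (b : R) (k : R^nat) :=
  forall t : R, `|t| < 1 -> pseries k t @ \oo --> (1 - t) `^ (- b).

(* [cesaro_num b n] is the number k^b(n) of the expansion of (1 - t)^(-b); such
   coefficients exist and are unique by [cesaro_numP] and [is_cesaro_num_inj]
   below. *)
Definition cesaro_num (R : realType) (b : R) : R^nat :=
  xget (fun=> 0) [set k | is_cesaro_num b k].

Definition alpha (R : realType) (a : R) : R^nat := cesaro_num (- a).

(* The partial sums of the series of c_n T^{*n} T^n, applied to [x]. *)
Definition hereditary_sum (R : realType) (H : hilbertType R)
    (c : R^nat) (T : H -> H) (N : nat) (x : H) : H :=
  \sum_(0 <= n < N) (c n)%:C *: iter n (adjoint T) (iter n T x).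

Definition a_contraction (R : realType) (H : hilbertType R)
    (a : R) (T : H -> H) :=
  sot_cvg (hereditary_sum (fun n => `|alpha a n|) T) /\
  positive_op (fun x => limn (fun N => hereditary_sum (alpha a) T N x)).

Definition quadratically_bounded (R : realType) (H : hilbertType R)
    (b : R) (T : H -> H) :=
  exists2 c : R, 0 < c & forall x : H,
    (ereal_sup [set ((cesaro_num (b + 1) n)^-1 *
        \sum_(0 <= j < n.+1) cesaro_num b (n - j)%N * hnorm (iter j T x) ^+ 2)%:E
      | n in [set: nat]] <= (c * hnorm x ^+ 2)%:E)%E.

Section cesaro_theory.
Variable R : realType.
Implicit Types (c u rho : R^nat) (t b : R).

Lemma ratio_cvg_series u rho (l : R) : (forall n, u n.+1 = rho n * u n) ->
  rho @ \oo --> l -> `|l| < 1 -> cvgn (series u).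
Proof.
move=> urho rhol l1.
pose q := (1 + `|l|) / 2.
have q0 : 0 <= q by rewrite /q; have := normr_ge0 l; lra.
have q1 : `|q| < 1 by rewrite ger0_norm// /q; lra.
have lq : `|l| < q by rewrite /q; lra.
have [N _ hN] : \forall n \near \oo, `|rho n| <= q.
  exact: (cvgr_norm_le _ rhol).
have uq n : `|u (n + N)%N| <= geometric `|u N| q n.
  elim: n => [|n IHn] /=; first by rewrite expr0 mulr1.
  rewrite addSn urho normrM exprS mulrCA.
  by apply: ler_pM => //; apply: hN; rewrite /= leq_addl.
rewrite -(is_cvg_series_restrict N).
have /cvg_ex[s us] : cvgn (series (fun n => u (n + N)%N)).
  apply: normed_cvg; apply: series_le_cvg uq _ => //.
  - by move=> n /=; rewrite mulr_ge0 ?exprn_ge0.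
  - exact: is_cvg_geometric_series.
apply/cvg_ex; exists s; rewrite -(cvg_shiftn N) /=.
apply: cvg_trans us; apply: near_eq_cvg; near=> n.
by rewrite /= -{2}(add0n N) big_addn addnK.
Unshelve. all: by end_near. Qed.

Lemma cvg_pseries_diffs c : (forall t, `|t| < 1 -> cvgn (pseries c t)) ->
  forall t, `|t| < 1 -> cvgn (pseries (pseries_diffs c) t).
Proof.
move=> cc t t1.
pose r := (1 + `|t|) / 2.
have r0 : 0 < r by rewrite /r; have := normr_ge0 t; lra.
have r1 : `|r| < 1 by rewrite gtr0_norm// /r; lra.
have tr : `|t| < r by rewrite /r; lra.
have [K [Kreal Kf]] := cvg_series_bounded (cc r r1).
pose M := `|K| + 1.
have KM : K < M by rewrite /M (le_lt_trans (ler_norm _))// ltrDl.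
pose q := `|t| / r.
have q0 : 0 <= q by rewrite divr_ge0// ltW.
have q1 : `|q| < 1 by rewrite ger0_norm// ltr_pdivrMr// mul1r.
pose v n : R := M / r * n.+1%:R * q ^+ n.
apply: normed_cvg; apply: (@series_le_cvg _ _ v).
- by move=> n; exact: normr_ge0.
- move=> n; rewrite /v; apply: mulr_ge0; last exact: exprn_ge0.
  by apply: mulr_ge0 => //; rewrite divr_ge0 ?(ltW r0)// /M addr_ge0.
- move=> n; rewrite /pseries_diffs /v /= !normrM normr_nat normrX.
  rewrite /q expr_div_n.
  have -> : M / r * n.+1%:R * (`|t| ^+ n / r ^+ n) =
    n.+1%:R * (M / r ^+ n.+1) * `|t| ^+ n.
    by rewrite exprS; field; rewrite expf_neq0 gt_eqF.
  rewrite ler_wpM2r ?exprn_ge0// ler_wpM2l// ler_pdivlMr ?exprn_gt0//.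
  have := Kf M KM n.+1 I; rewrite /= normrM normrX.
  by rewrite (gtr0_norm r0).
- apply: (@ratio_cvg_series _ (fun n => n.+2%:R / n.+1%:R * q) q) => //.
    move=> n; rewrite /v exprS.
    by field; rewrite gt_eqF//= -natr1 addrC; rewrite gt_eqF// ltr_wpDr.
  rewrite -[X in _ --> X]mul1r; apply: cvgMr_tmp.
  have -> : (fun n => n.+2%:R / n.+1%:R) = (fun n => 1 + @harmonic R n).
    by apply/funext => n; rewrite /harmonic/= -[n.+2%:R]natr1 addrC mulrDl mul1r divff// addrC.
  by rewrite -[X in _ --> X]addr0; apply: cvgD; [exact: cvg_cst|exact: cvg_harmonic].
Qed.

Lemma is_derive_pseries c : (forall t, `|t| < 1 -> cvgn (pseries c t)) ->
  forall t, `|t| < 1 -> is_derive t (1 : R) (fun x => limn (pseries c x))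
    (limn (pseries (pseries_diffs c) t)).
Proof.
move=> cc t t1.
pose r := (1 + `|t|) / 2.
have r0 : 0 < r by rewrite /r; have := normr_ge0 t; lra.
have r1 : `|r| < 1 by rewrite gtr0_norm// /r; lra.
have tr : `|t| < `|r| by rewrite (gtr0_norm r0) /r; lra.
apply: (@pseries_snd_diffs _ _ r) => //; first exact: cc.
  exact: cvg_pseries_diffs.
by do 2 apply: cvg_pseries_diffs => //.
Qed.

Lemma limn_pseries0 c : limn (pseries c 0) = c 0%N.
Proof.
apply: cvg_lim => //; rewrite -(cvg_shiftn 1).
rewrite (_ : (fun n => _) = cst (c 0%N)); first exact: cvg_cst.
apply/funext => n; rewrite /pseries /series /= addn1 big_nat_recl//= expr0 mulr1.
by rewrite big1 ?addr0// => i _; rewrite exprS mul0r mulr0.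
Qed.

Lemma pseries_eq0 c : (forall t, `|t| < 1 -> pseries c t @ \oo --> (0 : R)) ->
  c = fun=> 0.
Proof.
move=> c0; apply/funext => n; elim: n c c0 => [|n IHn] c c0.
  rewrite -limn_pseries0; apply: cvg_lim => //; apply: c0.
  by rewrite normr0.
have cc t : `|t| < 1 -> cvgn (pseries c t).
  by move=> t1; apply/cvg_ex; exists 0; exact: c0.
have /IHn : forall t, `|t| < 1 -> pseries (pseries_diffs c) t @ \oo --> (0 : R).
  move=> t t1; have dc := is_derive_pseries cc t1.
  have <- : limn (pseries (pseries_diffs c) t) = 0; last first.
    exact: cvg_pseries_diffs.
  rewrite -(@derive_val _ _ _ _ _ _ _ dc).
  rewrite (@near_eq_derive _ _ _ _ (cst 0)) ?derive_cst//.
    near=> x; apply: cvg_lim => //; apply: c0.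
    near: x.
    by have /cvgr_norm_lt := @cvg_id _ (nbhs t); exact.
by rewrite /pseries_diffs => /eqP; rewrite mulf_eq0 pnatr_eq0/= => /eqP.
Unshelve. all: by end_near. Qed.

Lemma is_cesaro_num_inj b c u : is_cesaro_num b c -> is_cesaro_num b u -> c = u.
Proof.
move=> hc hu; apply/funext => n.
have : (fun n => c n - u n) = (fun=> 0 : R).
  apply: pseries_eq0 => t t1; rewrite -(subrr ((1 - t) `^ (- b))).
  rewrite (_ : pseries _ t = (fun m => pseries c t m - pseries u t m)).
    by apply: cvgB; [exact: hc|exact: hu].
  apply/funext => m; rewrite /pseries /series /= -sumrB.
  by apply: eq_bigr => i _; rewrite mulrBl.
by move/(congr1 (fun f => f n))/eqP; rewrite subr_eq0 => /eqP.
Qed.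

Lemma is_cesaro_num_prod b :
  is_cesaro_num b (fun n => \prod_(0 <= j < n) ((b + j%:R) / j.+1%:R)).
Proof.
set k := (X in is_cesaro_num b X).
have k0 : k 0%N = 1 by rewrite /k big_geq.
have kS n : k n.+1 = (b + n%:R) / n.+1%:R * k n.
  by rewrite /k big_nat_recr//= mulrC.
have kc t : `|t| < 1 -> cvgn (pseries k t).
  move=> t1.
  apply: (@ratio_cvg_series _ (fun n => (b + n%:R) / n.+1%:R * t) t) => //.
    by move=> n; rewrite /= kS exprS; field; rewrite ?natr1 ?nat1r ?pnatr_eq0.
  rewrite -[X in _ --> X]mul1r; apply: cvgMr_tmp.
  have -> : (fun n => (b + n%:R) / n.+1%:R) =
            (fun n => 1 + (b - 1) * @harmonic R n).
    apply/funext => n; rewrite /harmonic/= -natr1.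
    by field; rewrite ?natr1 ?nat1r ?pnatr_eq0.
  rewrite -[X in _ --> X]addr0; apply: cvgD; first exact: cvg_cst.
  rewrite -[X in _ --> X](mulr0 (b - 1)).
  by apply: cvgMl_tmp; exact: cvg_harmonic.
pose f x := limn (pseries k x).
have dk := cvg_pseries_diffs kc.
have df t : `|t| < 1 ->
    (1 - t) * limn (pseries (pseries_diffs k) t) = b * f t.
  move=> t1.
  have dkt := dk t t1.
  have dkt' := pseries_diffs_equiv dkt.
  rewrite mulrBl mul1r; apply/eqP; rewrite subr_eq; apply/eqP.
  have dktE : (fun n => b * pseries k t n +
      t * series (fun i => i%:R * k i * t ^+ i.-1) n) @ \oo -->
      b * f t + t * limn (pseries (pseries_diffs k) t).
    apply: cvgD; first by apply: cvgMl_tmp; exact: (kc _ t1).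
    by apply: cvgMl_tmp; exact: dkt'.
  rewrite -(cvg_lim _ dktE)//; congr (limn _).
  apply/funext => n; rewrite /pseries /series /= !mulr_sumr -big_split /=.
  apply: eq_bigr => -[|i] _ /=.
    by rewrite /pseries_diffs kS; field.
  by rewrite /pseries_diffs kS exprS; field; rewrite ?natr1 ?nat1r ?pnatr_eq0.
pose g x := f x * (1 - x) `^ b.
have itv1 (x : R) : `|x| < 1 -> 0 < 1 - x.
  by move=> x1; rewrite subr_gt0 (le_lt_trans (ler_norm x)).
have dg t : `|t| < 1 -> is_derive t (1 : R) g 0.
  move=> t1.
  have dft : is_derive t (1 : R) f (limn (pseries (pseries_diffs k) t)).
    exact: is_derive_pseries.
  have dp : is_derive t (1 : R) (fun x => (1 - x) `^ b) (- (b * (1 - t) `^ (b - 1))).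
    have h1 : is_derive (1 - t) (1 : R) (@powR R ^~ b) (b * (1 - t) `^ (b - 1)).
      by apply: is_derive1_powR; exact: itv1.
    have h2 : is_derive t (1 : R) (fun x => 1 - x) (-1).
      by apply: is_derive_eq; rewrite add0r mul1r.
    have := @is_derive1_comp _ (@powR R ^~ b) (fun x : R => 1 - x) _ _ _ h1 h2.
    by rewrite mulrN1.
  apply: is_derive_eq.
  rewrite /GRing.scale/=.
  have -> : (1 - t) `^ b = (1 - t) `^ (b - 1) * (1 - t).
    rewrite -{3}(powRr1 (ltW (itv1 _ t1))) -powRD ?subrK//.
    by rewrite (gt_eqF (itv1 _ t1)) implybT.
  by rewrite -mulrA df//; ring.
have gE t : `|t| < 1 -> g t = 1.
  have g0 : g 0 = 1 by rewrite /g /f limn_pseries0 k0 mul1r subr0 powR1.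
  move=> t1.
  have H (x y : R) : -1 < x -> x <= y -> y < 1 -> g y = g x.
    move=> x1 xy y1; apply/eqP; rewrite -subr_eq0; apply/eqP.
    have [||z _ ->] := @MVT_segment _ g (cst 0) x y xy; last by rewrite mul0r.
    - move=> z; rewrite in_itv/= => /andP[xz zy]; apply: dg.
      by rewrite ltr_norml; apply/andP; split; lra.
    - apply: derivable_within_continuous => z; rewrite in_itv/= => /andP[xz zy].
      by apply: ex_derive; apply: dg; rewrite ltr_norml; apply/andP; split; lra.
  rewrite -g0; move: t1; rewrite ltr_norml => /andP[t1 t2].
  have [t0|/ltW t0] := leP 0 t; first by apply: H => //; rewrite ltrN10.
  by apply/esym; apply: H.
move=> t t1.
have -> : (1 - t) `^ (- b) = f t; last exact: kc.
have := gE t t1; rewrite /g powRN => gt1.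
rewrite -[RHS](mulfK (x := (1 - t) `^ b)) ?gt1 ?mul1r//.
by rewrite gt_eqF// powR_gt0// itv1.
Qed.

Lemma cesaro_numP b : is_cesaro_num b (cesaro_num b).
Proof. exact: xgetPex (ex_intro _ _ (@is_cesaro_num_prod b)). Qed.

Lemma cesaro_numE b n :
  cesaro_num b n = \prod_(0 <= j < n) ((b + j%:R) / j.+1%:R).
Proof.
by rewrite (@is_cesaro_num_inj b _ _ (@cesaro_numP b) (@is_cesaro_num_prod b)).
Qed.

End cesaro_theory.

Section hilbert_theory.
Variables (R : realType) (H : hilbertType R).
Implicit Types (x y z : H).

Local Notation ip x y := (complex.Re (dotp x y)).

Let ReD (u v : R[i]) : complex.Re (u + v) = complex.Re u + complex.Re v.
Proof. by case: u v => [? ?] []. Qed.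

Let ReM (t : R) (v : R[i]) : complex.Re (t%:C * v) = t * complex.Re v.
Proof. by case: v => a b /=; rewrite mul0r subr0. Qed.

Let ReiM (v : R[i]) : complex.Re ('i%C * v) = - complex.Im v.
Proof. by case: v => a b /=; rewrite mul0r mul1r sub0r. Qed.

Let ReJ (v : R[i]) : complex.Re (Num.conj v) = complex.Re v.
Proof. by case: v. Qed.

Lemma hnormE x : `|x| = (hnorm x)%:C.
Proof.
have := normr_ge0 x; rewrite /hnorm lecE /= => /andP[/eqP].
by case: (`|x|) => a b /= ->.
Qed.

Lemma hnorm_ge0 x : 0 <= hnorm x.
Proof. by have := normr_ge0 x; rewrite hnormE ler0c. Qed.

Lemma hnorm_sqr x : hnorm x ^+ 2 = ip x x.
Proof. by rewrite dotp_norm hnormE -rmorphXn. Qed.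

Let ipDl x y z : ip (x + y) z = ip x z + ip y z.
Proof. by rewrite linearDl ReD. Qed.

Let ipZl t x y : ip (t%:C *: x) y = t * ip x y.
Proof. by rewrite linearZl_LR /= ReM. Qed.

Let ipC x y : ip x y = ip y x.
Proof. by rewrite (hermC _ x y) expr0 mul1r; exact: ReJ. Qed.

Let ipDr x y z : ip z (x + y) = ip z x + ip z y.
Proof. by rewrite ipC ipDl !(ipC z). Qed.

Let ipZr t x y : ip x (t%:C *: y) = t * ip x y.
Proof. by rewrite ipC ipZl ipC. Qed.

Let ipBl x y z : ip (x - y) z = ip x z - ip y z.
Proof. by apply/eqP; rewrite eq_sym subr_eq -ipDl subrK. Qed.

Let ipBr x y z : ip z (x - y) = ip z x - ip z y.
Proof. by rewrite ipC ipBl !(ipC z). Qed.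

Let quad_ge0 (p q s : R) : 0 <= s -> 0 <= q ->
  (forall t, 0 <= q + 2 * t * p + t ^+ 2 * s) -> p ^+ 2 <= q * s.
Proof.
move=> s0 q0 h; have [s_eq0|s_neq0] := eqVneq s 0.
  have := h (- (q + 1) / (2 * p)); rewrite s_eq0 !mulr0 addr0.
  have [->|p0] := eqVneq p 0; first by rewrite expr0n => _.
  rewrite [X in _ <= X](_ : _ = -1); last by field.
  by rewrite ler0N1.
have s_gt0 : 0 < s by rewrite lt_neqAle eq_sym s_neq0.
have := h (- p / s).
rewrite [X in _ <= X](_ : _ = (q * s - p ^+ 2) / s); last by field.
by rewrite pmulr_lge0 ?invr_gt0// subr_ge0.
Qed.

Lemma ip_le x y : `|ip x y| <= hnorm x * hnorm y.
Proof.
rewrite -(@ler_pXn2r _ 2)// ?nnegrE ?mulr_ge0 ?hnorm_ge0//.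
rewrite exprMn real_normK ?num_real// !hnorm_sqr; apply: quad_ge0.
- by rewrite -hnorm_sqr sqr_ge0.
- by rewrite -hnorm_sqr sqr_ge0.
- move=> t; rewrite [X in _ <= X](_ : _ = hnorm (x + t%:C *: y) ^+ 2) ?sqr_ge0//.
  by rewrite hnorm_sqr !(ipDl, ipDr, ipZl, ipZr) (ipC y x); ring.
Qed.

Lemma riesz (f : H -> R[i]) (C : R) :
  (forall x y, f (x + y) = f x + f y) ->
  (forall (t : R[i]) x, f (t *: x) = t * f x) ->
  (forall x, `|complex.Re (f x)| <= C * hnorm x) ->
  exists z, forall x, f x = dotp x z.
Proof.
move=> fD fZ fC.
pose r x := complex.Re (f x).
have rD x y : r (x + y) = r x + r y by rewrite /r fD ReD.
have rZ t x : r (t%:C *: x) = t * r x by rewrite /r fZ ReM.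
have rB x y : r (x - y) = r x - r y.
  by apply/eqP; rewrite eq_sym subr_eq -rD subrK.
pose Q x := hnorm x ^+ 2 - 2 * r x.
have Qlb : has_lbound (range Q).
  exists (- C ^+ 2) => _ [x _ <-].
  have := fC x; rewrite ler_norml => /andP[_ h].
  have := sqr_ge0 (hnorm x - C); rewrite /Q /r sqrrB => h2.
  by nra.
pose m := inf (range Q).
have Qm x : m <= Q x by apply: ge_inf => //; exists x.
have /choice[u uQ] (n : nat) : exists x, Q x < m + n.+1%:R^-1.
  have [||_ [x _ <-] h] := @inf_adherent _ (range Q) (n.+1%:R^-1) _ _.
  - by rewrite invr_gt0.
  - by split => //; exists (Q 0), 0.
  - by exists x.
have QD x h t : Q (x + t%:C *: h) = Q x + 2 * t * (ip h x - r h) + t ^+ 2 * hnorm h ^+ 2.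
  rewrite /Q !hnorm_sqr rD rZ !(ipDl, ipDr, ipZl, ipZr) (ipC x h).
  by ring.
have par x y : hnorm (x - y) ^+ 2 <= 2 * (Q x - m) + 2 * (Q y - m).
  have := Qm (x + (2^-1)%:C *: (y - x)).
  rewrite /Q !hnorm_sqr !(rB, rD, rZ) !(ipBl, ipBr, ipDl, ipDr, ipZl, ipZr).
  rewrite (ipC y x).
  lra.
have u_cauchy : cauchy (u @ \oo).
  apply/cauchy_ballP => e e0.
  have [d d0 ed] : exists2 d : R, 0 < d & e = d%:C.
    by move: e0; case: e => a b; rewrite ltcE /= => /andP[/eqP -> a0]; exists a.
  have d4 : 0 < d ^+ 2 / 4 by rewrite divr_gt0 ?exprn_gt0.
  have small : \forall n \near \oo, (n.+1%:R^-1 : R) < d ^+ 2 / 4.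
    by near=> n; near: n; exact: near_infty_natSinv_lt (PosNum d4).
  near_simpl; near=> a b => /=.
  rewrite -ball_normE /= ed hnormE ltcR.
  rewrite -(@ltr_pXn2r _ 2)// ?nnegrE ?hnorm_ge0 ?ltW//.
  apply: le_lt_trans (par _ _) _.
  have ha : (a.+1%:R^-1 : R) < d ^+ 2 / 4 by near: a.
  have hb : (b.+1%:R^-1 : R) < d ^+ 2 / 4 by near: b.
  have ua : Q (u a) - m < d ^+ 2 / 4 by rewrite ltrBlDl (lt_trans (uQ a))// ltrD2l.
  have ub : Q (u b) - m < d ^+ 2 / 4 by rewrite ltrBlDl (lt_trans (uQ b))// ltrD2l.
  move: ua ub; move: (Q (u a) - m) (Q (u b) - m) (d ^+ 2) => p q s; lra.
have /cvg_ex[z uz] : cvgn u by exact/cauchy_cvgP.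
have hz h : ip h z = r h.
  have key (t : R) : 0 <= 2 * t * (ip h z - r h) + t ^+ 2 * hnorm h ^+ 2.
    apply/ler_addgt0Pr => e e0.
    pose w := 2 * `|t| * hnorm h + 1.
    have w0 : 0 < w by rewrite /w ltr_wpDl// !mulr_ge0 ?hnorm_ge0.
    have e2 : 0 < e / 2 by rewrite divr_gt0.
    have ew : 0 < (e / 2 / w)%:C by rewrite ltcR divr_gt0.
    near \oo => n.
    have h1 : hnorm (u n - z) < e / 2 / w.
      rewrite -ltcR -hnormE; near: n.
      by apply: cvgr_distC_lt uz _ ew.
    have h2 : (n.+1%:R^-1 : R) < e / 2.
      by near: n; exact: near_infty_natSinv_lt (PosNum e2).
    have h3 := uQ n.
    have := Qm (u n + t%:C *: h); rewrite QD => h4.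
    have h5 : 2 * t * (ip h (u n) - ip h z) <= e / 2.
      have -> : ip h (u n) - ip h z = ip h (u n - z).
        by rewrite ipBr.
      apply: le_trans (ler_norm _) _; rewrite !normrM normr_nat.
      apply: (@le_trans _ _ (2 * `|t| * (hnorm h * hnorm (u n - z)))).
        by rewrite ler_wpM2l ?mulr_ge0// ip_le.
      rewrite mulrA; apply: (@le_trans _ _ (w * hnorm (u n - z))).
        by rewrite ler_wpM2r ?hnorm_ge0// /w lerDl.
      by rewrite mulrC -ler_pdivlMr// ltW.
    have {}h3 : Q (u n) < m + e / 2 by rewrite (lt_trans h3)// ltrD2l.
    clear h2; move: h3 h4 h5.
    move: (Q (u n)) (ip h (u n)) (ip h z) (r h) (hnorm h) => p q s v w'.
    lra.
  have : (ip h z - r h) ^+ 2 <= 0 * hnorm h ^+ 2.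
    apply: quad_ge0 => // [|t]; first exact: sqr_ge0.
    by rewrite add0r.
  rewrite mul0r => h0; apply/eqP; rewrite -subr_eq0 -sqrf_eq0 eq_le h0.
  exact: sqr_ge0.
exists z => x.
have := hz x; have := hz ('i%C *: x).
rewrite /r fZ linearZl_LR /= !ReiM => /oppr_inj.
by case: (f x) (dotp x z) => [a b] [c d] /= -> ->.
Unshelve. all: by end_near. Qed.

Lemma adjointP (T : {linear H -> H}) : continuous T ->
  forall x y, dotp (T x) y = dotp x (adjoint T y).
Proof.
move=> /linear_bounded_continuous/linear_boundedP[M [Mreal TM]] x y.
have [C TC] : exists C : R, forall x, hnorm (T x) <= C * hnorm x.
  have M1 : M < `|M| + 1.
    by rewrite (le_lt_trans (real_ler_norm Mreal))// ltrDl.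
  exists (complex.Re (`|M| + 1)) => z.
  have := TM _ M1 z; rewrite !hnormE.
  have : 0 <= `|M| + 1 by rewrite addr_ge0.
  case: (`|M| + 1) => a b; rewrite lecE /= => /andP[/eqP -> _].
  by rewrite lecE /= => /andP[_]; rewrite mulr0 subr0.
have [||t|z zP] := @riesz (fun x => dotp (T x) y) (C * hnorm y).
- by move=> u v; rewrite linearD linearDl.
- by move=> u v; rewrite linearZ linearZl_LR.
- apply: le_trans (ip_le _ _) _; rewrite mulrAC ler_wpM2r ?hnorm_ge0//.
by move: x; apply: (@xgetPex _ 0 [set z | forall x, dotp (T x) y = dotp x z]); exists z.
Qed.

End hilbert_theory.

(* Main.v *)
Require Import Defs.
From mathcomp Require Import all_boot all_order all_algebra.
From mathcomp Require Import all_classical all_reals all_analysis.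
From mathcomp Require Import complex ring lra.

(* Fix [x] and [n], and put [v j = |T^j x|^2] and [V m = v (n - m)]. Since
   [alpha a l <= 0] for [l >= 1], the hypothesis on [T] makes every partial sum
   of [\sum_l alpha a l * v (l + m)] nonnegative, that is, [W = alpha a * V] is
   nonnegative on [0, n], with [*] the convolution. As [k^a] is the convolution
   inverse of [alpha a], one has [V = k^a * W], so the Cesaro sum of [v] is the
   sum over [i <= n] of [W i] times [\sum_(i <= m <= n) k^b m * k^a (m - i)].
   For [b <= 1 < a + b] the latter is at most a constant times
   [k^(b+1) n * k^a (n - i)], and [\sum_i k^a (n - i) * W i = V n = v 0].
   The case [b > 1] follows from [b = 1] by a convolution with [k^(b-1)]. *)

Import Order.TTheory GRing.Theory Num.Theory.
Import numFieldNormedType.Exports.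

Local Open Scope classical_set_scope.
Local Open Scope ring_scope.

(** * Convolution of sequences over a commutative ring *)

Section convolution.
Variable R : comNzRingType.
Implicit Types u v w : nat -> R.

Definition conv u v n := \sum_(i < n.+1) u i * v (n - i)%N.

(** Up to index [n], convolution is multiplication of truncated polynomials, which is associative
    and commutative. *)
Lemma coef_conv n u v i : (i <= n)%N ->
  conv u v i = (\poly_(j < n.+1) u j * \poly_(j < n.+1) v j)`_i.
Proof.
move=> lein; rewrite coefM; apply: eq_bigr => j _.
rewrite !coef_poly !ltnS (leq_trans (leq_subr _ _) lein).
by rewrite (leq_trans _ lein) // -ltnS.
Qed.

Lemma convA u v w n : conv u (conv v w) n = conv (conv u v) w n.
Proof.
pose P f := \poly_(j < n.+1) (f j : R).
transitivity ((P u * (P v * P w))`_n).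
  rewrite coefM; apply: eq_bigr => j _.
  by rewrite coef_poly ltn_ord -coef_conv // leq_subr.
rewrite mulrA coefM; apply: eq_bigr => j _.
by rewrite coef_poly ltnS leq_subr -coef_conv // -ltnS.
Qed.

Lemma convC u v n : conv u v n = conv v u n.
Proof. by rewrite (coef_conv n u v) // (coef_conv n v u) // mulrC. Qed.

End convolution.

Arguments conv {R} u v n.
Arguments coef_conv {R} n {u v i}.

(** * Identities and summation bounds for Cesaro numbers *)

Section cesaro_numbers.
Variable R : realType.
Implicit Types (a b c : R) (n : nat).
Local Notation k := (@cesaro_num R).

Lemma cesaro_num0 b : k b 0%N = 1.
Proof. by rewrite cesaro_numE big_geq. Qed.

Lemma cesaro_numS b n : n.+1%:R * k b n.+1 = (b + n%:R) * k b n.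
Proof.
rewrite !cesaro_numE big_nat_recr //= mulrCA mulrC; congr (_ * _).
by rewrite mulrC divfK // pnatr_eq0.
Qed.

Lemma cesaro_num_ge0 b n : 0 <= b -> 0 <= k b n.
Proof.
move=> b0; rewrite cesaro_numE; apply: prodr_ge0 => i _.
by rewrite divr_ge0 ?addr_ge0.
Qed.

Lemma cesaro_num_gt0 b n : 0 < b -> 0 < k b n.
Proof.
move=> b0; rewrite cesaro_numE; apply: prodr_gt0 => i _.
by rewrite divr_gt0 ?ltr_wpDr.
Qed.

Lemma alphaS_le0 a n : 0 <= a <= 1 -> alpha a n.+1 <= 0.
Proof.
move=> /andP[a0 a1]; rewrite /alpha cesaro_numE big_nat_recl //=.
rewrite mulr_le0_ge0 //; first by rewrite addr0 divr1 oppr_le0.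
apply: prodr_ge0 => i _; rewrite divr_ge0 // addrC subr_ge0.
by rewrite (le_trans a1) // ler1n.
Qed.

Lemma cesaro_num_nonincr b : 0 <= b <= 1 ->
  {homo k b : m n / (m <= n)%N >-> n <= m}.
Proof.
move=> /andP[b0 b1]; apply: homo_leq => //; first by move=> y x z /[swap]; exact: le_trans.
move=> n; rewrite -(ler_pM2l (ltr0Sn _ n)) cesaro_numS.
by rewrite ler_wpM2r ?cesaro_num_ge0 // -natr1 addrC lerD2l.
Qed.

Lemma cesaro_num_nondecr b : 1 <= b -> {homo k b : m n / (m <= n)%N >-> m <= n}.
Proof.
move=> b1; apply: homo_leq => //; first by move=> y x z; exact: le_trans.
move=> n; rewrite -(ler_pM2l (ltr0Sn _ n)) cesaro_numS.
by rewrite ler_wpM2r ?cesaro_num_ge0 ?(le_trans ler01) // -natr1 addrC lerD2r.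
Qed.

(** Both sides are [b (b + 1) ... (b + n) / n!]. *)
Lemma cesaro_num_shift b n : b * k (b + 1) n = (b + n%:R) * k b n.
Proof.
elim: n => [|n IHn]; first by rewrite !cesaro_num0 addr0.
apply: (mulfI (x := n.+1%:R)); first by rewrite pnatr_eq0.
rewrite [LHS]mulrCA cesaro_numS [RHS]mulrCA [in RHS]cesaro_numS.
by rewrite [LHS]mulrCA IHn -natr1; ring.
Qed.

(** Coefficientwise form of [(1 - t)^(-b) (1 - t)^(-c) = (1 - t)^(-(b + c))], by induction on the
    recurrence [cesaro_numS]. *)
Lemma conv_cesaro_num b c n : conv (k b) (k c) n = k (b + c) n.
Proof.
elim: n => [|n IHn].
  by rewrite /conv big_ord1 !cesaro_num0 mulr1.
apply: (mulfI (x := n.+1%:R)); first by rewrite pnatr_eq0.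
rewrite cesaro_numS -IHn /conv.
(* The factor [n.+1] splits as [i + (n.+1 - i)], so that [cesaro_numS] applies in each part. *)
transitivity (\sum_(i < n.+2) (i%:R * k b i * k c (n.+1 - i)%N +
    k b i * ((n.+1 - i)%:R * k c (n.+1 - i)%N))).
  rewrite mulr_sumr; apply: eq_bigr => i _.
  have lei : (i <= n.+1)%N by rewrite -ltnS.
  by rewrite natrB //; ring.
rewrite big_split /= big_ord_recl /= !mul0r add0r.
rewrite [X in _ + X]big_ord_recr /= subnn !mul0r mulr0 addr0 -big_split /=.
rewrite mulr_sumr; apply: eq_bigr => i _.
have lein : (i <= n)%N by rewrite -ltnS.
rewrite /bump /= add1n subSS cesaro_numS subSn // cesaro_numS natrB //; ring.
Qed.

(* With [d = a + b - 1], the induction step is the inequality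
   [(j + 1) (j + a) (j + b) >= (j + d) (j + 1) ^ 2], whose two sides differ by
   [(1 - a) (1 - b) (j + 1)]. *)
Lemma sum_cesaro_numM_le a b n : 0 < a <= 1 -> 0 < b <= 1 -> 1 < a + b ->
  (a + b - 1) * \sum_(m < n.+1) k b m * k a m <= b * k (b + 1) n * k a n.
Proof.
move=> /andP[a0 a1] /andP[b0 b1] ab1.
(* As [a <= 1], the factor [b + n] from [cesaro_num_shift] dominates [n + (a + b - 1)]; this sharper
   bound, an equality at [n = 0], is the one proved by induction. *)
apply: (@le_trans _ _ ((n%:R + (a + b - 1)) * (k b n * k a n))); last first.
  rewrite cesaro_num_shift -mulrA ler_wpM2r //.
    by rewrite mulr_ge0 ?cesaro_num_ge0 // ltW.
  lra.
elim: n => [|n IHn]; first by rewrite big_ord1 add0r.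
rewrite big_ord_recr /= mulrDr -lerBrDr (le_trans IHn) //.
have hb := cesaro_numS b n; have ha := cesaro_numS a n.
have n1 : 0 < n.+1%:R :> R by [].
set y := k b n.+1 * k a n.+1; set z := k b n * k a n.
have z0 : 0 <= z by rewrite mulr_ge0 ?cesaro_num_ge0 // ltW.
have yz : n.+1%:R ^+ 2 * y = (b + n%:R) * (a + n%:R) * z.
  by rewrite /y /z expr2 [LHS]mulrACA hb ha [LHS]mulrACA.
rewrite -mulrBl addrK -(ler_pM2l n1) [leRHS]mulrA -expr2 yz mulrA ler_wpM2r //.
rewrite -natr1.
have : 0 <= (1 - a) * (1 - b) by rewrite mulr_ge0 ?subr_ge0.
lra.
Qed.

Lemma cesaro_sum_le_of_le1 {a b : R} {v : nat -> R} n :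
    0 < a <= 1 -> 0 < b <= 1 -> 1 < a + b ->
    (forall m N, 0 <= \sum_(l < N.+1) alpha a l * v (l + m)%N) ->
  \sum_(m < n.+1) k b m * v (n - m)%N <=
    b / (a + b - 1) * k (b + 1) n * v 0%N.
Proof.
move=> ha hb ab1 wv.
have a0 : 0 <= a by case/andP: ha => /ltW.
have b0 : 0 <= b by case/andP: hb => /ltW.
pose V m := v (n - m)%N; pose W := conv (alpha a) V.
have W0 m : (m <= n)%N -> 0 <= W m.
  (* Since [n - (m - l) = l + (n - m)], [W m] is the sum in the hypothesis at shift [n - m]. *)
  move=> lemn; have := wv (n - m)%N m; congr (0 <= _).
  apply: eq_bigr => l _; congr (_ * v _).
  have lelm : (l <= m)%N by rewrite -ltnS.
  by rewrite subnBA // addnC addnBAC.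
have VW m : V m = \sum_(i < m.+1) W i * k a (m - i)%N.
  transitivity (conv W (k a) m) => //.
  (* [k 0] is the unit of convolution: 1 at index 0, and 0 elsewhere. *)
  have kalpha i : conv (k a) (alpha a) i = k 0 i.
    by rewrite conv_cesaro_num subrr.
  rewrite convC convA /conv (bigD1 ord0) //= subn0.
  rewrite [X in X * _]kalpha cesaro_num0 mul1r big1 ?addr0 // => i i0.
  rewrite [X in X * _]kalpha cesaro_numE.
  case: i i0 => -[//|i] ? _ /=.
  by rewrite big_nat_recl //= addr0 !mul0r.
have d0 : 0 < a + b - 1 by lra.
have S i : (i <= n)%N ->
    \sum_(i <= m < n.+1) k b m * k a (m - i)%N <=
      b / (a + b - 1) * k (b + 1) n * k a (n - i)%N.
  move=> lein; rewrite -{1}(add0n i) big_addn subSn // big_mkord.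
  (* Since [b <= 1], [k b (m + i)] is at most [k b m], which leaves the sum of [sum_cesaro_numM_le]
     up to [n - i]. *)
  apply: (@le_trans _ _ (\sum_(m < (n - i).+1) k b m * k a m)).
    apply: ler_sum => m _; rewrite addnK ler_wpM2r ?cesaro_num_ge0 //.
    by apply: cesaro_num_nonincr; [rewrite b0; case/andP: hb|exact: leq_addr].
  rewrite -(ler_pM2l d0) (le_trans (sum_cesaro_numM_le a b _ ha hb ab1)) //.
  have -> : (a + b - 1) * (b / (a + b - 1) * k (b + 1) n * k a (n - i)%N) =
      b * k (b + 1) n * k a (n - i)%N by field; rewrite gt_eqF.
  rewrite ler_wpM2r ?cesaro_num_ge0 // ler_wpM2l //.
  by apply: cesaro_num_nondecr; [rewrite lerDr|exact: leq_subr].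
have -> : \sum_(m < n.+1) k b m * v (n - m)%N =
    \sum_(0 <= i < n.+1) W i * \sum_(i <= m < n.+1) k b m * k a (m - i)%N.
  transitivity (\sum_(0 <= m < n.+1) \sum_(0 <= i < n.+1 | (i <= m)%N)
      W i * (k b m * k a (m - i)%N)).
    rewrite big_mkord; apply: eq_bigr => m _.
    rewrite -/(V m) VW mulr_sumr -(big_mkord xpredT
      (fun i => k b m * (W i * k a (m - i)%N))).
    rewrite (big_nat_widen _ _ n.+1) //.
    by apply: eq_big => i //= _; rewrite mulrCA.
  rewrite (exchange_big_dep_nat xpredT) //=; apply: eq_bigr => i _.
  by rewrite mulr_sumr [RHS](big_nat_widenl _ 0).
have -> : v 0%N = V n by rewrite /V subnn.
rewrite VW mulr_sumr big_mkord; apply: ler_sum => i _.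
have lein : (i <= n)%N by rewrite -ltnS.
by rewrite mulrCA ler_wpM2l ?W0 // S.
Qed.

Lemma cesaro_sum_le {a b : R} : 0 < a <= 1 -> 1 - a < b ->
  exists2 c : R, 0 < c & forall v : nat -> R,
    (forall m N, 0 <= \sum_(l < N.+1) alpha a l * v (l + m)%N) ->
    forall n, \sum_(m < n.+1) k b m * v (n - m)%N <= c * k (b + 1) n * v 0%N.
Proof.
move=> ha ab; have /andP[a0 a1] := ha.
have [b1|b1] := leP b 1.
  exists (b / (a + b - 1)); first by rewrite divr_gt0 //; lra.
  by move=> v wv n; apply: cesaro_sum_le_of_le1 => //; lra.
(* The constant of [cesaro_sum_le_of_le1] at [b = 1]. *)
exists (1 / (a + 1 - 1)) => [|v wv n]; first by rewrite divr_gt0 //; lra.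
set c := 1 / _.
have -> : \sum_(m < n.+1) k b m * v (n - m)%N = conv (k (b - 1)) (conv (k 1) v) n.
  rewrite convA; apply: eq_bigr => m _.
  by rewrite conv_cesaro_num subrK.
have -> : k (b + 1) n = conv (k (b - 1)) (k (1 + 1)) n.
  by rewrite conv_cesaro_num; congr (k _ n); ring.
rewrite mulrAC mulrC mulr_suml; apply: ler_sum => i _.
rewrite -mulrA ler_wpM2l ?cesaro_num_ge0 ?subr_ge0 ?(ltW b1) //.
by rewrite mulrCA mulrA; apply: cesaro_sum_le_of_le1 => //; lra.
Qed.

End cesaro_numbers.

(** * Scalar inequalities along the orbits of an a-contraction *)

Section a_contractions.
Variables (R : realType) (H : hilbertType R).
Implicit Types (x y : H) (T : {linear H -> H}) (a : R).

Lemma dotp_iter_adjoint {T} n x y : continuous T ->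
  dotp x (iter n (adjoint T) y) = dotp (iter n T x) y.
Proof.
by move=> T_cont; elim: n y => // n IHn y; rewrite iterSr IHn -adjointP.
Qed.

Lemma Re_dotp_sym x y : complex.Re (dotp x y) = complex.Re (dotp y x).
Proof. by rewrite (hermC _ x y) expr0 mul1r /=; case: (dotp y x) => p q. Qed.

Lemma Re_dotp_hereditary_sum (c : R^nat) T N x : continuous T ->
  complex.Re (dotp x (hereditary_sum c T N x)) =
  \sum_(l < N) c l * hnorm (iter l T x) ^+ 2.
Proof.
move=> T_cont; rewrite Re_dotp_sym /hereditary_sum big_mkord linear_sumlz raddf_sum.
apply: eq_bigr => l _.
rewrite linearZl_LR hnorm_sqr -dotp_iter_adjoint // Re_dotp_sym.
by rewrite /=; case: (dotp _ _) => p q /=; rewrite mul0r subr0.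
Qed.

(** The partial sums are nonincreasing once the term [l = 0] is included, and their limit is
    nonnegative by positivity at [iter m T x]. *)
Lemma a_contraction_hereditary_ge0 {a T} m N x :
    0 <= a <= 1 -> continuous T -> a_contraction a T ->
  0 <= \sum_(l < N.+1) alpha a l * hnorm (iter (l + m) T x) ^+ 2.
Proof.
move=> ha T_cont [[A [_ A_lim]] pos].
pose y := iter m T x.
under eq_bigr do rewrite iterD -/y.
pose s n := \sum_(l < n) alpha a l * hnorm (iter l T y) ^+ 2.
pose u n := hereditary_sum (alpha a) T n y.
have u_cvg : cvgn u.
  (* Since [alpha a 0 = 1] and later coefficients are nonpositive, the signed and absolute sums add
     up to [2 y]. Convergence of [u] gives [limn u] its meaning as a limit. *)
  have E n : u n.+1 = y + y - hereditary_sum (fun n => `|alpha a n|) T n.+1 y.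
    rewrite /u /hereditary_sum !big_nat_recl //= /alpha !cesaro_num0 normr1.
    rewrite scale1r opprD addrA addrK -sumrN; congr (_ + _).
    apply: eq_bigr => i _; rewrite -scaleNr -rmorphN /=; congr (_%:C%C *: _).
    by rewrite ler0_norm ?opprK // -/(alpha a _) alphaS_le0.
  apply/cvg_ex; exists (y + y - A y); rewrite -(cvg_shiftS u) /=.
  rewrite (funext E); apply: cvgB; first exact: cvg_cst.
  by rewrite (cvg_shiftS (fun n => hereditary_sum _ T n y)); exact: A_lim.
have s_decr n : (N < n)%N -> s n <= s N.+1.
  elim: n => // n IHn; rewrite ltnS leq_eqVlt => /predU1P[<-//|Nn].
  rewrite (le_trans _ (IHn Nn)) // /s big_ord_recr /= gerDl.
  case: n Nn {IHn} => // n _.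
  by rewrite mulr_le0_ge0 ?sqr_ge0 // alphaS_le0.
have L0 : 0 <= complex.Re (dotp (limn u) y).
  by have := pos y; rewrite -/u; case: (dotp _ _) => p q; rewrite lecE => /andP[].
rewrite leNgt; apply/negP => sN; rewrite -/(s N.+1) in sN.
(* By Cauchy-Schwarz, an error below [e] in norm changes the pairing with [y] by less than
   [- s N.+1]; the [+ 1] in the witness covers [hnorm y = 0]. *)
have [e e0 he] : exists2 e : R, 0 < e & e * hnorm y < - s N.+1.
  have p0 : 0 < hnorm y + 1 by rewrite ltr_wpDl ?hnorm_ge0.
  exists (- s N.+1 / (hnorm y + 1)); first by rewrite divr_gt0 ?oppr_gt0.
  by rewrite mulrAC ltr_pdivrMr // ltr_pM2l ?oppr_gt0 // ltrDl.
have : \forall n \near \oo, False; last by case=> ? _ /(_ _ (leqnn _)).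
near=> n.
have h1 : hnorm (limn u - u n) < e.
  rewrite -ltcR -hnormE; near: n.
  by apply: cvgr_dist_lt; [exact: u_cvg|rewrite ltcR].
have h2 : s n <= s N.+1 by apply: s_decr; near: n; exact: nbhs_infty_gt.
have := ip_le (limn u - u n) y; rewrite ler_norml => /andP[_].
apply/negP; rewrite -ltNge (le_lt_trans (ler_wpM2r _ (ltW h1))) ?hnorm_ge0 //.
rewrite (lt_le_trans he) // linearBl raddfB /=.
rewrite (Re_dotp_sym (u n)) Re_dotp_hereditary_sum // -/(s n).
by rewrite -[leLHS]add0r lerB.
Unshelve. all: by end_near. Qed.

End a_contractions.

Theorem theorem1p14 (R : realType) (H : hilbertType R) (sepH : separable H)
  (a : R) (a_gt0 : 0 < a) (a_lt1 : a < 1)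
  (T : {linear H -> H}) (T_cont : continuous T) (T_contr : a_contraction a T)
  (b : R) (b_gt : 1 - a < b) :
  quadratically_bounded b T.
Proof.
have ha : 0 < a <= 1 by rewrite a_gt0 ltW.
have [c c0 hc] := cesaro_sum_le _ ha b_gt.
exists c => // x; apply: ge_ereal_sup => _ [n _ <-]; rewrite lee_fin.
rewrite ler_pdivrMl; last by apply: cesaro_num_gt0; lra.
pose v j := hnorm (iter j T x) ^+ 2.
have wv m N : 0 <= \sum_(l < N.+1) alpha a l * v (l + m)%N.
  by apply: a_contraction_hereditary_ge0; rewrite ?ltW.
rewrite mulrA [X in X * _]mulrC (le_trans _ (hc v wv n)) //.
(* The index [n - j] sits on the weight in the goal and on [v] in [hc]; commutativity exchanges
   them. *)
rewrite -/(conv (cesaro_num b) v n) convC big_mkord.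
by under eq_bigr do rewrite mulrC.
Qed.
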